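(* Let $t_n$ (the number of tree-like polyhexes with $n+1$ hexagons) be defined by $t_0=t_1=1$ and $(n+1)t_n=3(2n-1)t_{n-1}-5(n-2)t_{n-2}$ for $n\geq 2$. The sequence $\{t_n\}_{n\geq 2}$ is ratio log-concave, and the sequence $\{\sqrt[n]{t_n}\}_{n\geq 1}$ is strictly log-concave.
   Context: A sequence $(x_n)_{n\ge m}$ of positive reals is log-concave if $x_n^2\ge x_{n-1}x_{n+1}$ for all $n\ge m+1$, strictly log-concave if the inequality is strict. A sequence $(a_n)_{n\ge m}$ of positive reals is ratio log-concave if $(a_{n+1}/a_n)_{n\ge m}$ is log-concave. *)

(* Defs.v *)
From Stdlib Require Import Reals.
Open Scope R_scope.

(* A sequence (x_n)_{n >= m} is a total function x : nat -> R of which only the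
   values at indices n >= m matter. *)

Definition positive_from (m : nat) (x : nat -> R) : Prop :=
  forall n : nat, (m <= n)%nat -> 0 < x n.

Definition log_concave_from (m : nat) (x : nat -> R) : Prop :=
  positive_from m x /\
  forall n : nat, (m + 1 <= n)%nat -> x n ^ 2 >= x (n - 1)%nat * x (n + 1)%nat.

Definition strictly_log_concave_from (m : nat) (x : nat -> R) : Prop :=
  positive_from m x /\
  forall n : nat, (m + 1 <= n)%nat -> x n ^ 2 > x (n - 1)%nat * x (n + 1)%nat.

Definition ratio_log_concave_from (m : nat) (a : nat -> R) : Prop :=
  positive_from m a /\
  log_concave_from m (fun n => a (n + 1)%nat / a n).

(* The positive n-th root x^(1/n), for x > 0 and n >= 1; Rpower is
   exp (1/n * ln x), a junk value outside this range. *)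
Definition nth_root (n : nat) (x : R) : R := Rpower x (/ INR n).

(* Main.v *)
Require Import Defs.
From Stdlib Require Import Reals Lra Lia.
Open Scope R_scope.

(** The ratios [r n = t (n+1) / t n] satisfy
    [r n = rec_a n - rec_b n / r (n-1)]. Expressing [r (n-1)] and [r (n+1)]
    through [x = r n], the inequality [r n ^ 2 >= r (n-1) * r (n+1)] becomes
    [0 <= quartic n x]. The quartic is concave in [x] on [[3, oo)], so it is
    enough to trap [r n] between [3] and a bound [ratio_ub n] at both of which
    the quartic is nonnegative. For the roots, put [L n = ln (t n)]; then
    [E n = 2 (n^2-1) L n - n (n+1) L (n-1) - n (n-1) L (n+1)] satisfies
    [E (n+1) - E n = n (n+1) (2 ln (r n) - ln (r (n-1)) - ln (r (n+1)))], which
    is nonnegative for [n >= 3], so only [E 2] and [E 3] have to be checked. *)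

(** * Bounds on the ratios *)

Definition rec_a (x : R) : R := 3 * (2 * x + 1) / (x + 2).

Definition rec_b (x : R) : R := 5 * (x - 1) / (x + 2).

(* The first three terms are those of the asymptotic expansion of [r n] in powers
   of [1 / (n + 2)]. The true next coefficient is [45/16], and the quartic stays
   nonnegative to leading order up to [15/2]; [7] makes the induction start at
   [n = 4]. *)
Definition ratio_ub (x : R) : R :=
  5 - 15 / (2 * (x + 2)) + 15 / (16 * (x + 2) ^ 2) + 7 / (x + 2) ^ 3.

Definition quartic (n x : R) : R :=
  rec_a n * x ^ 3 - x ^ 4 - rec_b n * rec_a (n + 1) * x + rec_b n * rec_b (n + 1).

Ltac horner_pos :=
  repeat (apply Rplus_le_le_0_compat; [lra | apply Rmult_le_pos; [lra |]]); lra.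

Lemma ratio_ub_ge_3 (n : R) : 4 <= n -> 3 <= ratio_ub n.
Proof.
  intros Hn. unfold ratio_ub.
  assert (H1 : 15 / (2 * (n + 2)) <= 15 / 12).
  { apply Rmult_le_compat_l; [lra |]. apply Rinv_le_contravar; lra. }
  assert (H2 : 0 < 15 / (16 * (n + 2) ^ 2)).
  { apply Rdiv_lt_0_compat; [lra |].
    apply Rmult_lt_0_compat; [lra | apply pow_lt; lra]. }
  assert (H3 : 0 < 7 / (n + 2) ^ 3).
  { apply Rdiv_lt_0_compat; [lra | apply pow_lt; lra]. }
  lra.
Qed.

Lemma ratio_ub_rec (n : R) :
  5 <= n -> rec_a n - rec_b n / ratio_ub (n - 1) <= ratio_ub n.
Proof.
  intros Hn.
  pose proof (ratio_ub_ge_3 (n - 1) ltac:(lra)) as Hu.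
  assert (H : 0 <= ratio_ub n * ratio_ub (n - 1)
                   - rec_a n * ratio_ub (n - 1) + rec_b n).
  (* The shift by 5 makes every coefficient of the numerator positive. The leading one is
     [4288 = 1024 * (7 - 45/16)], so it is positive because 7 exceeds the true coefficient. *)
  { set (k := n - 5).
    replace n with (k + 5) by (unfold k; ring).
    assert (Hk : 0 <= k) by (unfold k; lra). clearbody k.
    replace (_ + rec_b (k + 5)) with
      ((291690 + k * (242853 + k * (58521 + k * 4288)))
       / (256 * (k + 6) ^ 3 * (k + 7) ^ 3)).
    2:{ unfold ratio_ub, rec_a, rec_b. field. lra. }
    apply Rle_mult_inv_pos; [horner_pos |].
    repeat apply Rmult_lt_0_compat; try apply pow_lt; lra. }
  apply Rmult_le_reg_r with (ratio_ub (n - 1)); [lra |].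
  replace ((rec_a n - rec_b n / ratio_ub (n - 1)) * ratio_ub (n - 1))
    with (rec_a n * ratio_ub (n - 1) - rec_b n) by (field; lra).
  lra.
Qed.

Lemma rec_b_pos (n : R) : 1 < n -> 0 < rec_b n.
Proof. intros Hn. unfold rec_b. apply Rdiv_lt_0_compat; lra. Qed.

(** As [rec_b n > 0], the map [y -> rec_a n - rec_b n / y] is increasing, so only the two ends of
    the interval have to be checked. *)
Lemma ratio_bounds_step (n y : R) :
  5 <= n -> 3 <= y <= ratio_ub (n - 1) ->
  3 <= rec_a n - rec_b n / y <= ratio_ub n.
Proof.
  intros Hn [Hy1 Hy2].
  pose proof (rec_b_pos n ltac:(lra)) as Hb.
  split.
  - assert (H : rec_b n / y <= rec_b n / 3).
    { apply Rmult_le_compat_l; [lra |]. apply Rinv_le_contravar; lra. }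
    assert (H3 : 0 <= rec_a n - rec_b n / 3 - 3).
    { replace (rec_a n - rec_b n / 3 - 3) with (4 * (n - 1) / (3 * (n + 2)))
        by (unfold rec_a, rec_b; field; lra).
      apply Rle_mult_inv_pos; lra. }
    lra.
  - assert (H : rec_b n / ratio_ub (n - 1) <= rec_b n / y).
    { apply Rmult_le_compat_l; [lra |]. apply Rinv_le_contravar; lra. }
    pose proof (ratio_ub_rec n Hn). lra.
Qed.

(** * Positivity of the quartic *)

(** As [n] grows the quartic tends to [6 x^3 - x^4 - 30 x + 25], which vanishes at 5, the limit of
    [ratio_ub]. The margin is thus small, about [40 / n^3], where [40 = 80 * (15/2 - 7)]. *)
Lemma quartic_ratio_ub_ge0 (n : R) : 4 <= n -> 0 <= quartic n (ratio_ub n).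
Proof.
  intros Hn. set (k := n - 4).
  replace n with (k + 4) by (unfold k; ring).
  assert (Hk : 0 <= k) by (unfold k; lra). clearbody k.
  replace (quartic _ _) with
    ((457387593952400 + k * (740921195554640 + k * (535246127638584
      + k * (226729618245568 + k * (62244709866433 + k * (11542511897775
      + k * (1459110576720 + k * (123544696800 + k * (6655564800
      + k * (203484160 + k * 2621440))))))))))
     / (65536 * (k + 6) ^ 12 * (k + 7))).
  2:{ unfold quartic, ratio_ub, rec_a, rec_b. field. lra. }
  apply Rle_mult_inv_pos; [horner_pos |].
  repeat apply Rmult_lt_0_compat; try apply pow_lt; lra.
Qed.

Lemma quartic_3_ge0 (n : R) : 4 <= n -> 0 <= quartic n 3.
Proof.
  intros Hn. set (k := n - 4).
  replace n with (k + 4) by (unfold k; ring).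
  assert (Hk : 0 <= k) by (unfold k; lra). clearbody k.
  replace (quartic _ _) with
    ((516 + k * (220 + k * 16)) / ((k + 6) * (k + 7))).
  2:{ unfold quartic, rec_a, rec_b. field. lra. }
  apply Rle_mult_inv_pos; [horner_pos | apply Rmult_lt_0_compat; lra].
Qed.

(* Concavity, through the exact remainder of the chord interpolation. *)
Lemma quartic_concave (n l u x : R) :
  -2 < n -> 3 <= l -> l <= x <= u ->
  0 <= quartic n l -> 0 <= quartic n u -> 0 <= quartic n x.
Proof.
  intros Hn Hl [Hlx Hxu] Ql Qu.
  destruct (Req_dec l u) as [E | E].
  { now replace x with l by lra. }
  assert (Ha : rec_a n <= 6).
  { assert (0 < 9 / (n + 2)) by (apply Rdiv_lt_0_compat; lra).
    replace (rec_a n) with (6 - 9 / (n + 2)) by (unfold rec_a; field; lra).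
    lra. }
  (* [S] is minus the second divided difference of the quartic at [l], [x], [u]. With
     [s = x + l + u >= 9] and [rec_a n <= 6], it is at least [2/3 s^2 - 6 s >= 0]. *)
  set (S := x ^ 2 + l ^ 2 + u ^ 2 + x * l + x * u + l * u
            - rec_a n * (x + l + u)).
  assert (HS : 0 <= S).
  { unfold S.
    assert (0 <= (6 - rec_a n) * (x + l + u)) by (apply Rmult_le_pos; lra).
    nra. }
  apply Rmult_le_reg_l with (u - l); [lra |].
  replace ((u - l) * quartic n x) with
    ((u - x) * quartic n l + (x - l) * quartic n u
     + (x - l) * (u - x) * (u - l) * S) by (unfold S, quartic; ring).
  rewrite Rmult_0_r.
  repeat apply Rplus_le_le_0_compat; repeat apply Rmult_le_pos; lra.
Qed.

Lemma quartic_ge0 (n x : R) :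
  4 <= n -> 3 <= x <= ratio_ub n -> 0 <= quartic n x.
Proof.
  intros Hn Hx.
  apply quartic_concave with 3 (ratio_ub n); try lra.
  - now apply quartic_3_ge0.
  - now apply quartic_ratio_ub_ge0.
Qed.

(** Solving the recurrence backwards gives [y = rec_b n / (rec_a n - x)], whence [x (rec_a n - x)
    (x^2 - y z) = quartic n x] with a positive factor in front. *)
Lemma three_term_log_concave (n y x z : R) :
  1 < n -> 0 < y -> 0 < x ->
  x = rec_a n - rec_b n / y -> z = rec_a (n + 1) - rec_b (n + 1) / x ->
  0 <= quartic n x -> y * z <= x ^ 2.
Proof.
  intros Hn Hy Hx Ex Ez Q.
  pose proof (rec_b_pos n Hn) as Hb.
  assert (Eb : rec_b n = y * (rec_a n - x)).
  { rewrite Ex. field. lra. }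
  assert (Ha : 0 < rec_a n - x).
  { apply Rmult_lt_reg_l with y; lra. }
  apply Rmult_le_reg_l with (x * (rec_a n - x));
    [now apply Rmult_lt_0_compat |].
  replace (x * (rec_a n - x) * (y * z)) with
    (rec_b n * rec_a (n + 1) * x - rec_b n * rec_b (n + 1)).
  2:{ rewrite Eb, Ez. field. lra. }
  unfold quartic in Q. lra.
Qed.

(** * Ratio log-concavity and roots *)

Lemma ln_ratio_log_concave (p q r s : R) :
  0 < p -> 0 < q -> 0 < r -> 0 < s ->
  (q / p) * (s / r) <= (r / q) ^ 2 ->
  (ln q - ln p) + (ln s - ln r) <= 2 * (ln r - ln q).
Proof.
  intros Hp Hq Hr Hs H.
  assert (ln_div : forall x y, 0 < x -> 0 < y -> ln (x / y) = ln x - ln y).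
  { intros x y Hx Hy. unfold Rdiv.
    rewrite ln_mult, ln_Rinv by auto using Rinv_0_lt_compat. ring. }
  pose proof (Rdiv_lt_0_compat _ _ Hq Hp). pose proof (Rdiv_lt_0_compat _ _ Hs Hr).
  pose proof (Rdiv_lt_0_compat _ _ Hr Hq).
  assert (Hln : ln (q / p * (s / r)) <= ln ((r / q) ^ 2)).
  { destruct H as [H | H]; [left | right; now rewrite H].
    apply ln_increasing; [now apply Rmult_lt_0_compat | exact H]. }
  rewrite ln_mult, ln_pow, !ln_div in Hln by assumption.
  simpl INR in Hln. lra.
Qed.

Lemma nth_root_strictly_log_concave (m : nat) (a : nat -> R) :
  (1 <= m)%nat ->
  (forall n, (m + 1 <= n)%nat ->
     0 < 2 * (INR n ^ 2 - 1) * ln (a n)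
         - INR n * (INR n + 1) * ln (a (n - 1)%nat)
         - INR n * (INR n - 1) * ln (a (n + 1)%nat)) ->
  strictly_log_concave_from m (fun n => nth_root n (a n)).
Proof.
  intros Hm H. split.
  - intros n _. apply exp_pos.
  - intros n Hn. specialize (H n Hn). unfold nth_root, Rpower.
    rewrite <- exp_plus. simpl pow. rewrite Rmult_1_r, <- exp_plus.
    apply Rlt_gt, exp_increasing.
    rewrite minus_INR, plus_INR by lia. simpl (INR 1).
    assert (Hx : 2 <= INR n) by (apply (le_INR 2); lia).
    set (x := INR n) in *.
    (* This factor clears the denominators of the three exponents [1/n], [1/(n-1)], [1/(n+1)]. *)
    assert (Hd : 0 < x * (x - 1) * (x + 1))
      by (repeat apply Rmult_lt_0_compat; lra).
    apply Rmult_lt_reg_l with (1 := Hd).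
    apply Rlt_0_minus.
    match goal with |- 0 < ?e => replace e with
      (2 * (x ^ 2 - 1) * ln (a n) - x * (x + 1) * ln (a (n - 1)%nat)
       - x * (x - 1) * ln (a (n + 1)%nat)) by (field; lra) end.
    exact H.
Qed.

(** * The tree-like polyhex sequence *)

Section TreeLikePolyhexes.

Variable t : nat -> R.
Hypothesis ht0 : t 0%nat = 1.
Hypothesis ht1 : t 1%nat = 1.
Hypothesis htrec : forall n : nat, (2 <= n)%nat ->
  (INR n + 1) * t n =
    3 * (2 * INR n - 1) * t (n - 1)%nat - 5 * (INR n - 2) * t (n - 2)%nat.

Lemma t_values :
  t 2%nat = 3 /\ t 3%nat = 10 /\ t 4%nat = 36 /\ t 5%nat = 137.
Proof.
  pose proof (htrec 2 ltac:(lia)) as H2. pose proof (htrec 3 ltac:(lia)) as H3.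
  pose proof (htrec 4 ltac:(lia)) as H4. pose proof (htrec 5 ltac:(lia)) as H5.
  simpl in *. repeat split; lra.
Qed.

Lemma t_ratio_rec (n : nat) :
  0 < t n -> 0 < t (n + 1)%nat ->
  t (n + 2)%nat / t (n + 1)%nat =
  rec_a (INR n + 1) - rec_b (INR n + 1) / (t (n + 1)%nat / t n).
Proof.
  intros H0 H1.
  pose proof (htrec (n + 2) ltac:(lia)) as H.
  replace (n + 2 - 1)%nat with (n + 1)%nat in H by lia.
  replace (n + 2 - 2)%nat with n in H by lia.
  rewrite plus_INR in H. simpl (INR 2) in H.
  pose proof (pos_INR n) as Hn.
  unfold rec_a, rec_b.
  apply Rmult_eq_reg_l with ((INR n + 3) * t (n + 1)%nat);
    [| apply Rgt_not_eq, Rmult_lt_0_compat; lra].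
  transitivity ((INR n + 3) * t (n + 2)%nat); [field; lra |].
  replace (INR n + 3) with (INR n + (1 + 1) + 1) at 1 by ring.
  rewrite H. field. lra.
Qed.

(** The recurrence subtracts a term, so positivity is not immediate from it. It is carried through
    the induction, where a ratio of at least 3 makes the next term positive. *)
Lemma t_bounds (n : nat) :
  (4 <= n)%nat ->
  0 < t n /\ 0 < t (n + 1)%nat /\
  3 <= t (n + 1)%nat / t n <= ratio_ub (INR n).
Proof.
  destruct t_values as (_ & _ & H4 & H5).
  induction 1 as [| n Hn (IH1 & IH2 & IH3)].
  - simpl (4 + 1)%nat. rewrite H4, H5.
    unfold ratio_ub. simpl INR. lra.
  - assert (Hx : 4 <= INR n) by (replace 4 with (INR 4) by (simpl; ring);
                                 now apply le_INR).
    pose proof (t_ratio_rec n IH1 IH2) as Hr.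
    assert (B : 3 <= t (n + 2)%nat / t (n + 1)%nat <= ratio_ub (INR n + 1)).
    { rewrite Hr. apply ratio_bounds_step; [lra |].
      now replace (INR n + 1 - 1) with (INR n) by ring. }
    rewrite S_INR. replace (S n) with (n + 1)%nat by lia.
    replace (n + 1 + 1)%nat with (n + 2)%nat by lia.
    repeat split; try tauto.
    replace (t (n + 2)%nat) with (t (n + 2)%nat / t (n + 1)%nat * t (n + 1)%nat)
      by (field; lra).
    apply Rmult_lt_0_compat; lra.
Qed.

Lemma t_pos (n : nat) : 0 < t n.
Proof.
  destruct t_values as (H2 & H3 & _).
  destruct n as [| [| [| [| n]]]]; try lra.
  apply t_bounds. lia.
Qed.

Lemma t_ratio_log_concave (n : nat) :
  (2 <= n)%nat ->
  (t (n + 1)%nat / t n) * (t (n + 3)%nat / t (n + 2)%nat)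
  <= (t (n + 2)%nat / t (n + 1)%nat) ^ 2.
Proof.
  intros Hn.
  (* The middle ratio has index [n + 1], and the bounds start at index 4, so [n = 2] is computed
     directly. *)
  destruct (Nat.eq_dec n 2) as [-> | Hne].
  { destruct t_values as (H2 & H3 & H4 & H5). simpl Nat.add.
    rewrite H2, H3, H4, H5. lra. }
  assert (Hx : 3 <= INR n) by (replace 3 with (INR 3) by (simpl; ring);
                               apply le_INR; lia).
  pose proof (t_ratio_rec n (t_pos _) (t_pos _)) as R1.
  pose proof (t_ratio_rec (n + 1) (t_pos _) (t_pos _)) as R2.
  destruct (t_bounds (n + 1) ltac:(lia)) as (_ & _ & B).
  replace (n + 1 + 1)%nat with (n + 2)%nat in * by lia.
  replace (n + 1 + 2)%nat with (n + 3)%nat in * by lia.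
  rewrite plus_INR in R2, B. simpl (INR 1) in R2, B.
  apply three_term_log_concave with (n := INR n + 1); try assumption; try lra.
  - apply Rdiv_lt_0_compat; apply t_pos.
  - apply quartic_ge0; lra.
Qed.

Lemma ln_t_condition (n : nat) :
  (2 <= n)%nat ->
  0 < 2 * (INR n ^ 2 - 1) * ln (t n)
      - INR n * (INR n + 1) * ln (t (n - 1)%nat)
      - INR n * (INR n - 1) * ln (t (n + 1)%nat).
Proof.
  destruct t_values as (H2 & H3 & H4 & _).
  intros Hn. destruct (Nat.eq_dec n 2) as [-> | Hne].
  { simpl Nat.sub. simpl Nat.add. rewrite ht1, H2, H3, ln_1. simpl INR.
    assert (H : ln 10 < ln (3 ^ 3)) by (apply ln_increasing; lra).
    rewrite ln_pow in H by lra. simpl INR in H. lra. }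
  assert (Hn3 : (3 <= n)%nat) by lia. clear Hn Hne.
  induction Hn3 as [| n Hn IH].
  - simpl Nat.sub. simpl Nat.add. rewrite H2, H3, H4. simpl INR.
    (* Here [E 3 = 16 ln 10 - 12 ln 3 - 6 ln 36], and half of it is the gap in this inequality. *)
    assert (H : ln (36 ^ 3 * 3 ^ 6) < ln (10 ^ 8)) by (apply ln_increasing; lra).
    rewrite ln_mult, !ln_pow in H by lra. simpl INR in H. lra.
  - pose proof (ln_ratio_log_concave _ _ _ _ (t_pos _) (t_pos _) (t_pos _)
      (t_pos _) (t_ratio_log_concave (n - 1) ltac:(lia))) as H.
    replace (n - 1 + 1)%nat with n in H by lia.
    replace (n - 1 + 2)%nat with (n + 1)%nat in H by lia.
    replace (n - 1 + 3)%nat with (n + 2)%nat in H by lia.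
    rewrite S_INR. replace (S n - 1)%nat with n by lia.
    replace (S n + 1)%nat with (n + 2)%nat by lia.
    replace (S n) with (n + 1)%nat by lia.
    pose proof (pos_INR n) as Hx.
    assert (0 <= INR n * (INR n + 1) *
      (2 * (ln (t (n + 1)%nat) - ln (t n))
       - (ln (t n) - ln (t (n - 1)%nat) + (ln (t (n + 2)%nat) - ln (t (n + 1)%nat))))).
    { apply Rmult_le_pos; [apply Rmult_le_pos |]; lra. }
    lra.
Qed.

End TreeLikePolyhexes.

Theorem theorem4p8 (t : nat -> R)
  (ht0 : t 0%nat = 1) (ht1 : t 1%nat = 1)
  (htrec : forall n : nat, (2 <= n)%nat ->
     (INR n + 1) * t n =
       3 * (2 * INR n - 1) * t (n - 1)%nat - 5 * (INR n - 2) * t (n - 2)%nat) :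
  ratio_log_concave_from 2 t /\
  strictly_log_concave_from 1 (fun n => nth_root n (t n)).
Proof.
  assert (Hpos : forall n, 0 < t n) by now apply t_pos.
  split.
  - split; [now intros n _ | split].
    + intros n _. now apply Rdiv_lt_0_compat.
    + intros n Hn. apply Rle_ge.
      pose proof (t_ratio_log_concave t ht0 ht1 htrec (n - 1) ltac:(lia)) as H.
      replace (n - 1 + 2)%nat with (n + 1)%nat in H by lia.
      replace (n - 1 + 3)%nat with (n + 1 + 1)%nat in H by lia.
      now replace (n - 1 + 1)%nat with n in * by lia.
  - apply nth_root_strictly_log_concave; [lia |].
    intros n Hn. apply ln_t_condition; auto; lia.
Qed.
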